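(* Let $R$ be a commutative ring and $d\ge1$. The quadratic $R$-algebra $R[\mathfrak{S}_d^{\mathrm{geo}}]$ is Koszul.
   Context: $\mathfrak{S}_d$ is the symmetric group on $\{1,\dots,d\}$, and $N(\sigma)$ is the minimal $m\ge0$ such that $\sigma\in\mathfrak{S}_d$ is a product of $m$ transpositions. $\mathfrak{S}_d^{\mathrm{geo}}$ is the partially multiplicative quandle with underlying set $\mathfrak{S}_d$, conjugation $\sigma^\tau=\tau^{-1}\sigma\tau$, and product $\sigma\tau$ defined if and only if $N(\sigma\tau)=N(\sigma)+N(\tau)$. $R[\mathfrak{S}_d^{\mathrm{geo}}]$ is the associative $R$-algebra that is free as an $R$-module on elements $[\sigma]$, $\sigma\in\mathfrak{S}_d$, with product $[\sigma][\tau]=[\sigma\tau]$ if $N(\sigma\tau)=N(\sigma)+N(\tau)$ and $[\sigma][\tau]=0$ otherwise; it is graded by putting $[\sigma]$ in degree $N(\sigma)$. A graded $R$-algebra is quadratic if its degree $1$ part is a free $R$-module and it is generated in degree $1$ with relations generated in degree $2$. Let $A$ be a graded associative $R$-algebra with $A_0=R$ and each $A_i$ a finitely generated free $R$-module; then $R$ is an $A$-module concentrated in degree $0$ via the canonical augmentation. The groups $\mathrm{Ext}^j_A(R,R)$ inherit an internal grading $\mathrm{Ext}^j_A(R,R)=\bigoplus_{\nu\ge0}\mathrm{Ext}^{j,\nu}_A(R,R)$, where $\mathrm{Ext}^{j,\nu}$ is computed by degree-preserving homomorphisms from a graded free resolution of $R$ to $R$ placed in degree $\nu$. $A$ is Koszul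 if for all $j\ge0$, $\mathrm{Ext}^j_A(R,R)$ is a finitely generated free $R$-module concentrated in degree $j$, i.e. $\mathrm{Ext}^j_A(R,R)=\mathrm{Ext}^{j,j}_A(R,R)$. *)

(* Defs.v *)
(* MathComp world; mathcomp.classical is used only for the pointwise module
   structure on function types. *)
From HB Require Import structures.
From mathcomp Require Import all_boot all_order all_algebra all_fingroup.
From mathcomp Require Import boolp functions.
Set Implicit Arguments.
Unset Strict Implicit.
Unset Printing Implicit Defensive.
Import GroupScope GRing.Theory.
Local Open Scope ring_scope.

(* MathComp's algType excludes the zero ring.  An associative algebra over a
   possibly trivial commutative ring R is a ring with a central morphism from
   R; amod is its underlying R-module. *)
Record ralgebra (R : comPzRingType) := RAlgebra {
  ralg :> pzRingType;
  rscal : {rmorphism R -> ralg};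
  rscalC : forall r a, rscal r * a = a * rscal r
}.

Section AlgebraModule.
Variables (R : comPzRingType) (A : ralgebra R).

Definition amod : Type := A.

HB.instance Definition _ := GRing.Zmodule.copy amod A.

Definition amod_scale (r : R) (a : amod) : amod := rscal A r * (a : A).

Fact amod_scaleA r s a :
  amod_scale r (amod_scale s a) = amod_scale (r * s) a.
Proof. by rewrite /amod_scale rmorphM mulrA. Qed.

Fact amod_scale1 : left_id 1 amod_scale.
Proof. by move=> a; rewrite /amod_scale rmorph1 mul1r. Qed.

Fact amod_scaleDr : right_distributive amod_scale +%R.
Proof. by move=> r a b; rewrite /amod_scale -mulrDr. Qed.

Fact amod_scaleDl a : {morph amod_scale^~ a : r s / r + s}.
Proof. by move=> r s; rewrite /amod_scale rmorphD mulrDl. Qed.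

HB.instance Definition _ := GRing.Zmodule_isLmodule.Build R amod
  amod_scaleA amod_scale1 amod_scaleDr amod_scaleDl.

End AlgebraModule.

(* For submodules B of Z: the classes of the family e form a basis of Z / B. *)
Definition basis_mod (S : pzRingType) (M : lmodType S) (Z B : M -> Prop)
    (I : choiceType) (e : I -> M) : Prop :=
  [/\ forall i, Z (e i),
      forall z, Z z ->
        exists (s : seq I) (c : I -> S), B (z - \sum_(i <- s) c i *: e i)
    & forall (s : seq I) (c : I -> S), uniq s ->
        B (\sum_(i <- s) c i *: e i) -> {in s, forall i, c i = 0}].

Definition zero_sub (M : zmodType) : M -> Prop := fun x => x = 0.

Definition full_sub (M : Type) : M -> Prop := fun=> True.

Definition fg_free_mod (S : pzRingType) (M : lmodType S) (Z B : M -> Prop) :=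
  exists (n : nat) (e : 'I_n -> M), basis_mod Z B e.

(* M is the internal direct sum of the additive subgroups G i. *)
Definition direct_sum (M : zmodType) (G : nat -> M -> Prop) : Prop :=
  [/\ forall i, G i 0 /\ (forall x y, G i x -> G i y -> G i (x - y)),
      forall x, exists (n : nat) (f : nat -> M),
        (forall i, G i (f i)) /\ x = \sum_(i < n) f i
    & forall (n : nat) (f : nat -> M), (forall i, G i (f i)) ->
        \sum_(i < n) f i = 0 -> forall i, (i < n)%N -> f i = 0].

(* Graded R-algebras with A_0 = R (identified by r |-> rscal r) and every A_i
   a finitely generated free R-module.  The canonical augmentation is recorded
   as a field, but it is determined by the grading. *)
Record graded_algebra (R : comPzRingType) := GradedAlgebra {
  galg :> ralgebra R;
  gdeg : nat -> galg -> Prop;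
  gdeg_sum : direct_sum gdeg;
  gdegM : forall i j a b, gdeg i a -> gdeg j b -> gdeg (i + j) (a * b);
  gdeg_scal : forall r : R, gdeg 0 (rscal galg r);
  gdeg_free : forall i,
    fg_free_mod (gdeg i : amod galg -> Prop) (@zero_sub (amod galg));
  gaug : {rmorphism galg -> R};
  gaug_scal : forall r : R, gaug (rscal galg r) = r;
  gaug_deg0 : forall a, gdeg 0 a -> a = rscal galg (gaug a);
  gaug_pos : forall i a, (0 < i)%N -> gdeg i a -> gaug a = 0
}.

(* Noncommutative polynomials in variables indexed by I, as formal sums of
   monomials (coefficient, word), up to equality of all coefficients. *)
Definition ncpoly (R : Type) (I : Type) := seq (R * seq I).

Section NCPoly.
Variables (R : comPzRingType) (I : choiceType).
Implicit Types p q a b : ncpoly R I.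

Definition nccoef p (w : seq I) : R := \sum_(t <- p | t.2 == w) t.1.

Definition nceq p q : Prop := nccoef p =1 nccoef q.

Definition ncmul p q : ncpoly R I :=
  [seq (t.1 * u.1, t.2 ++ u.2) | t <- p, u <- q].

Definition nchomog (m : nat) p : bool := all (fun t => size t.2 == m) p.

Definition nceval (A : ralgebra R) (x : I -> A) p : A :=
  \sum_(t <- p) rscal A t.1 * \prod_(i <- t.2) x i.

Inductive ncideal (K : ncpoly R I -> Prop) : ncpoly R I -> Prop :=
| ncideal_gen p : K p -> ncideal K p
| ncideal0 : ncideal K [::]
| ncidealD p q : ncideal K p -> ncideal K q -> ncideal K (p ++ q)
| ncidealM a p b : ncideal K p -> ncideal K (ncmul (ncmul a p) b)
| ncideal_eq p q : nceq p q -> ncideal K p -> ncideal K q.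

End NCPoly.

(* The tensor algebra of the free module A_1 with basis x is the algebra of
   noncommutative polynomials in the variables x. *)
Definition quadratic (R : comPzRingType) (A : graded_algebra R) : Prop :=
  exists (I : choiceType) (x : I -> A),
    [/\ basis_mod (gdeg 1 : amod A -> Prop) (@zero_sub (amod A))
          (x : I -> amod A),
        forall a : A, exists p : ncpoly R I, a = nceval x p
      & forall p : ncpoly R I, nceval x p = 0 ->
          ncideal (fun q => nchomog 2 q /\ nceval x q = 0) p].

Section GradedModules.
Variables (R : comPzRingType) (A : graded_algebra R).

Record graded_module := GradedModule {
  gmod :> lmodType A;
  mdeg : nat -> gmod -> Prop;
  mdeg_sum : direct_sum mdeg;
  mdegZ : forall i j (a : A) x,
    gdeg i a -> mdeg j x -> mdeg (i + j) (a *: x)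
}.

Definition degree_preserving (M N : graded_module) (f : M -> N) : Prop :=
  forall i x, mdeg i x -> mdeg i (f x).

Definition graded_free (M : graded_module) : Prop :=
  exists (I : choiceType) (e : I -> M) (deg : I -> nat),
    (forall i, mdeg (deg i) (e i)) /\
    basis_mod (@full_sub M) (@zero_sub M) e.

(* R as an A-module through the augmentation. *)
Definition trivmod : Type := let _ := A in R.

HB.instance Definition _ := GRing.Zmodule.copy trivmod R.

Definition trivmod_scale (a : A) (r : trivmod) : trivmod :=
  gaug A a * (r : R).

Fact trivmod_scaleA a b r :
  trivmod_scale a (trivmod_scale b r) = trivmod_scale (a * b) r.
Proof. by rewrite /trivmod_scale rmorphM mulrA. Qed.

Fact trivmod_scale1 : left_id 1 trivmod_scale.
Proof. by move=> r; rewrite /trivmod_scale rmorph1 mul1r. Qed.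

Fact trivmod_scaleDr : right_distributive trivmod_scale +%R.
Proof. by move=> a r s; rewrite /trivmod_scale -mulrDr. Qed.

Fact trivmod_scaleDl r : {morph trivmod_scale^~ r : a b / a + b}.
Proof. by move=> a b; rewrite /trivmod_scale rmorphD mulrDl. Qed.

HB.instance Definition _ := GRing.Zmodule_isLmodule.Build A trivmod
  trivmod_scaleA trivmod_scale1 trivmod_scaleDr trivmod_scaleDl.

Definition trivmod_deg (nu i : nat) (r : trivmod) : Prop := i = nu \/ r = 0.

Fact trivmod_deg_sum nu : direct_sum (trivmod_deg nu).
Proof.
split.
- move=> i; split=> [|x y]; first by right.
  case=> [->|->]; first by left.
  by case=> [->|->]; [left | right; rewrite subrr].
- move=> x; exists nu.+1, (fun i => if i == nu then x else 0); split.
    by move=> i; case: eqP => [->|_]; [left | right].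
  rewrite big_ord_recr /= eqxx big1 ?add0r // => i _.
  by rewrite ltn_eqF.
- move=> n f fP f0 i lin.
  case: (fP i) => // ei; move: f0; rewrite (bigD1 (Ordinal lin)) //= big1.
    by rewrite addr0.
  move=> j ji; case: (fP j) => // ej; case/eqP: ji; apply: val_inj => /=.
  by rewrite ej.
Qed.

Fact trivmod_degZ nu i j (a : A) x :
  gdeg i a -> trivmod_deg nu j x -> trivmod_deg nu (i + j) (a *: x).
Proof.
case: i => [|i] ha [->|->].
- by left.
- by right; rewrite scaler0.
- by right; rewrite /GRing.scale /= /trivmod_scale (gaug_pos _ ha) // mul0r.
- by right; rewrite scaler0.
Qed.

(* The A-module R placed in degree nu. *)
Definition trivmod_at (nu : nat) : graded_module :=
  GradedModule (@trivmod_deg_sum nu) (@trivmod_degZ nu).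

Record graded_free_resolution := GradedFreeResolution {
  res :> nat -> graded_module;
  res_free : forall j, graded_free (res j);
  res_d : forall j, {linear res j.+1 -> res j};
  res_aug : {linear res 0 -> trivmod_at 0};
  res_d_deg : forall j, degree_preserving (res_d j);
  res_aug_deg : degree_preserving res_aug;
  res_aug_surj : forall r, exists x, res_aug x = r;
  res_exact0 : forall x, res_aug x = 0 <-> exists y, res_d 0 y = x;
  res_exact : forall j x, res_d j x = 0 <-> exists y, res_d j.+1 y = x
}.

(* Cochains of degree j are maps P j -> R, viewed in the R-module of all
   functions P j -> R.  Ext^j is ext_cocycle / ext_coboundary, and Ext^(j, nu)
   is ext_cocycle_deg nu / ext_coboundary_deg nu. *)
Section Ext.
Variable P : graded_free_resolution.

Definition cochain (j : nat) := P j -> R^o.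

Definition ext_hom j (f : cochain j) : Prop :=
  linear (f : P j -> trivmod).

Definition ext_hom_deg (nu j : nat) (f : cochain j) : Prop :=
  ext_hom f /\ degree_preserving (f : P j -> trivmod_at nu).

Definition ext_d j (f : cochain j) : cochain j.+1 := fun x => f (res_d P j x).

Definition ext_cocycle j (f : cochain j) : Prop :=
  ext_hom f /\ ext_d f = 0.

Definition ext_coboundary j : cochain j -> Prop :=
  match j with
  | 0 => fun f => f = 0
  | k.+1 => fun f => exists2 g : cochain k, ext_hom g & f = ext_d g
  end.

Definition ext_cocycle_deg (nu j : nat) (f : cochain j) : Prop :=
  ext_hom_deg nu f /\ ext_d f = 0.

Definition ext_coboundary_deg (nu j : nat) : cochain j -> Prop :=
  match j with
  | 0 => fun f => f = 0
  | k.+1 => fun f => exists2 g : cochain k, ext_hom_deg nu g & f = ext_d g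
  end.

Definition ext_fg_free (j : nat) : Prop :=
  fg_free_mod (@ext_cocycle j) (@ext_coboundary j).

(* Ext^(j, nu) vanishes for nu <> m, and the map from Ext^(j, m) to Ext^j is
   injective and surjective. *)
Definition ext_concentrated (j m : nat) : Prop :=
  [/\ forall nu (f : cochain j), nu <> m ->
        ext_cocycle_deg nu f -> ext_coboundary_deg nu f,
      forall f : cochain j,
        ext_cocycle_deg m f -> ext_coboundary f -> ext_coboundary_deg m f
    & forall f : cochain j, ext_cocycle f ->
        exists2 g : cochain j, ext_cocycle_deg m g & ext_coboundary (f - g)].

End Ext.

(* Ext does not depend on the graded free resolution computing it. *)
Definition koszul : Prop :=
  exists P : graded_free_resolution,
    forall j, ext_fg_free P j /\ ext_concentrated P j j.

End GradedModules.

Section GeodesicLength.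
Variable d : nat.

Definition is_tperm_prod (s : 'S_d) (m : nat) : bool :=
  [exists ts : m.-tuple ('I_d * 'I_d),
     all (@dpair _) ts && (s == \prod_(t <- ts) tperm t.1 t.2)%g].

Lemma is_tperm_prodP s m :
  reflect (exists ts : seq ('I_d * 'I_d),
             [/\ size ts = m, all (@dpair _) ts
               & s = (\prod_(t <- ts) tperm t.1 t.2)%g])
          (is_tperm_prod s m).
Proof.
apply: (iffP existsP) => [[ts /andP[dts /eqP sE]]|[ts [sz dts sE]]].
  by exists ts; rewrite size_tuple.
have sz' : size ts == m by rewrite sz.
by exists (Tuple sz'); rewrite /= dts sE eqxx.
Qed.

Fact is_tperm_prod_ex s : exists m, is_tperm_prod s m.
Proof.
have [ts sE dts] := prod_tpermP s.
by exists (size ts); apply/is_tperm_prodP; exists ts.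
Qed.

(* N(s) *)
Definition tlen (s : 'S_d) : nat := ex_minn (is_tperm_prod_ex s).

Lemma tlenP s : is_tperm_prod s (tlen s).
Proof. by rewrite /tlen; case: ex_minnP. Qed.

Lemma tlen_min s m : is_tperm_prod s m -> (tlen s <= m)%N.
Proof. by rewrite /tlen; case: ex_minnP => n _; apply. Qed.

Lemma tlen1 : tlen 1 = 0%N.
Proof.
apply/eqP; rewrite -leqn0; apply/tlen_min/is_tperm_prodP.
by exists [::]; rewrite big_nil.
Qed.

Lemma tlen0 s : tlen s = 0%N -> s = 1%g.
Proof.
move=> s0; have := tlenP s; rewrite s0 => /is_tperm_prodP[ts [/size0nil-> _ ->]].
by rewrite big_nil.
Qed.

Lemma tlenM s t : (tlen (s * t)%g <= tlen s + tlen t)%N.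
Proof.
have /is_tperm_prodP[us [<- dus sE]] := tlenP s.
have /is_tperm_prodP[vs [<- dvs tE]] := tlenP t.
apply/tlen_min/is_tperm_prodP; exists (us ++ vs).
by rewrite size_cat all_cat dus dvs big_cat /= -sE -tE.
Qed.

Definition geodesic (s t : 'S_d) : bool :=
  tlen (s * t)%g == (tlen s + tlen t)%N.

Lemma geodesicA s t u :
  geodesic s t && geodesic (s * t)%g u = geodesic t u && geodesic s (t * u)%g.
Proof.
have h1 := tlenM s t; have h2 := tlenM t u.
have h3 := tlenM (s * t)%g u; have h4 := tlenM s (t * u)%g.
move: h3 h4; rewrite /geodesic mulgA.
set x := tlen (s * t * u)%g => h3 h4; apply/andP/andP => -[/eqP e1 /eqP e2].
  have : (tlen s + (tlen t + tlen u) <= tlen s + tlen (t * u)%g)%N.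
    by rewrite addnA -e1 -e2.
  rewrite leq_add2l => h5.
  have e3 : tlen (t * u)%g = (tlen t + tlen u)%N by apply/eqP; rewrite eqn_leq h2.
  by split; apply/eqP; rewrite // e2 e1 e3 addnA.
have : (tlen s + tlen t + tlen u <= tlen (s * t)%g + tlen u)%N.
  by rewrite -addnA -e1 -e2.
rewrite leq_add2r => h5.
have e3 : tlen (s * t)%g = (tlen s + tlen t)%N by apply/eqP; rewrite eqn_leq h1.
by split; apply/eqP; rewrite // e2 e1 e3 addnA.
Qed.

End GeodesicLength.

Section GeodesicAlgebra.
Variables (R : comPzRingType) (d : nat).

(* Functions from S_d to R, i.e. the free R-module on the elements [s];
   the product below is not the pointwise one.  MathComp composes
   permutations left to right; the other convention gives the opposite
   algebra, which is isomorphic to this one by inverting permutations. *)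
Definition geo_alg : Type := {ffun 'S_d -> R^o}.

HB.instance Definition _ := GRing.Lmodule.copy geo_alg {ffun 'S_d -> R^o}.

Implicit Types f g h : geo_alg.

Definition coord f (s : 'S_d) : R := (f : {ffun 'S_d -> R^o}) s.

Definition bas (s : 'S_d) : geo_alg := [ffun t => (t == s)%:R].

Definition bas_mul (s t : 'S_d) : geo_alg :=
  if geodesic s t then bas (s * t)%g else 0.

Definition geo_mul f g : geo_alg :=
  \sum_s \sum_t (coord f s * coord g t) *: bas_mul s t.

Lemma coordD f g s : coord (f + g) s = coord f s + coord g s.
Proof. by rewrite /coord ffunE. Qed.

Lemma coordZ k f s : coord (k *: f) s = k * coord f s.
Proof. by rewrite /coord ffunE. Qed.

Lemma coord0 s : coord 0 s = 0.
Proof. by rewrite /coord ffunE. Qed.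

Lemma coord_bas s t : coord (bas s) t = (t == s)%:R.
Proof. by rewrite /coord ffunE. Qed.

Lemma coord_sum (I : Type) (r : seq I) (F : I -> geo_alg) s :
  coord (\sum_(i <- r) F i) s = \sum_(i <- r) coord (F i) s.
Proof.
by elim/big_rec2: _ => [|i x y _ <-]; rewrite ?coord0 ?coordD.
Qed.

Lemma coordP f g : (forall s, coord f s = coord g s) -> f = g.
Proof. by move=> fg; apply/ffunP. Qed.

Lemma geo_decomp f : f = \sum_s coord f s *: bas s.
Proof.
apply: coordP => t; rewrite coord_sum (bigD1 t) //= big1.
  by rewrite coordZ coord_bas eqxx mulr1 addr0.
by move=> s st; rewrite coordZ coord_bas eq_sym (negPf st) mulr0.
Qed.

Lemma geo_mulDl : left_distributive geo_mul +%R.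
Proof.
move=> f g h; rewrite /geo_mul -big_split; apply: eq_bigr => s _ /=.
rewrite -big_split; apply: eq_bigr => t _ /=.
by rewrite coordD mulrDl scalerDl.
Qed.

Lemma geo_mulDr : right_distributive geo_mul +%R.
Proof.
move=> f g h; rewrite /geo_mul -big_split; apply: eq_bigr => s _ /=.
rewrite -big_split; apply: eq_bigr => t _ /=.
by rewrite coordD mulrDr scalerDl.
Qed.

Lemma geo_mulZl k f g : k *: geo_mul f g = geo_mul (k *: f) g.
Proof.
rewrite /geo_mul scaler_sumr; apply: eq_bigr => s _; rewrite scaler_sumr.
by apply: eq_bigr => t _; rewrite scalerA coordZ mulrA.
Qed.

Lemma geo_mulZr k f g : k *: geo_mul f g = geo_mul f (k *: g).
Proof.
rewrite /geo_mul scaler_sumr; apply: eq_bigr => s _; rewrite scaler_sumr.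
by apply: eq_bigr => t _; rewrite scalerA coordZ mulrCA.
Qed.

Lemma geo_mul0l f : geo_mul 0 f = 0.
Proof. by have := geo_mulZl 0 0 f; rewrite !scale0r => <-. Qed.

Lemma geo_mul0r f : geo_mul f 0 = 0.
Proof. by have := geo_mulZr 0 f 0; rewrite !scale0r => <-. Qed.

Lemma geo_ind (P : geo_alg -> Prop) : P 0 ->
  (forall f g, P f -> P g -> P (f + g)) ->
  (forall k f, P f -> P (k *: f)) -> (forall s, P (bas s)) -> forall f, P f.
Proof.
move=> P0 PD PZ Pb f; rewrite (geo_decomp f).
by elim/big_ind: _ => // s _; apply: PZ.
Qed.

Lemma geo_mul_bas s t : geo_mul (bas s) (bas t) = bas_mul s t.
Proof.
rewrite /geo_mul (bigD1 s) //= (bigD1 t) //= !big1 ?addr0.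
- by rewrite !coord_bas !eqxx mulr1 scale1r.
- move=> u us; rewrite big1 // => v _.
  by rewrite coord_bas (negPf us) mul0r scale0r.
- by move=> v vt; rewrite (coord_bas t) (negPf vt) mulr0 scale0r.
Qed.

Lemma geo_mulA : associative geo_mul.
Proof.
move=> f g h; elim/geo_ind: f => [|f f' Ef Ef'|k f Ef|s].
- by rewrite !geo_mul0l.
- by rewrite !geo_mulDl Ef Ef'.
- by rewrite -!geo_mulZl Ef.
elim/geo_ind: g => [|g g' Eg Eg'|k g Eg|t].
- by rewrite !(geo_mul0l, geo_mul0r).
- by rewrite !(geo_mulDl, geo_mulDr) Eg Eg'.
- by rewrite -!(geo_mulZl, geo_mulZr) Eg.
elim/geo_ind: h => [|h h' Eh Eh'|k h Eh|u].
- by rewrite !geo_mul0r.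
- by rewrite !geo_mulDr Eh Eh'.
- by rewrite -!geo_mulZr Eh.
rewrite !geo_mul_bas /bas_mul; have := geodesicA s t u.
case: (geodesic s t); case: (geodesic t u) => /= E;
  rewrite ?geo_mul0l ?geo_mul0r ?geo_mul_bas /bas_mul ?E ?mulgA //.
by rewrite -E.
Qed.

Lemma geodesic1s (s : 'S_d) : geodesic 1 s.
Proof. by rewrite /geodesic mul1g tlen1. Qed.

Lemma geodesics1 (s : 'S_d) : geodesic s 1.
Proof. by rewrite /geodesic mulg1 tlen1 addn0. Qed.

Lemma geo_mul1l : left_id (bas 1) geo_mul.
Proof.
elim/geo_ind=> [|f g Ef Eg|k f Ef|s]; first exact: geo_mul0r.
- by rewrite geo_mulDr Ef Eg.
- by rewrite -geo_mulZr Ef.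
by rewrite geo_mul_bas /bas_mul geodesic1s mul1g.
Qed.

Lemma geo_mul1r : right_id (bas 1) geo_mul.
Proof.
elim/geo_ind=> [|f g Ef Eg|k f Ef|s]; first exact: geo_mul0l.
- by rewrite geo_mulDl Ef Eg.
- by rewrite -geo_mulZl Ef.
by rewrite geo_mul_bas /bas_mul geodesics1 mulg1.
Qed.

HB.instance Definition _ := GRing.Zmodule_isPzRing.Build geo_alg
  geo_mulA geo_mul1l geo_mul1r geo_mulDl geo_mulDr.

Definition geo_scal (r : R) : geo_alg := r *: bas 1.

Lemma geo_scalE r f : geo_scal r * f = r *: f.
Proof. by rewrite /geo_scal; rewrite -[LHS]geo_mulZl geo_mul1l. Qed.

Fact geo_scalC r f : geo_scal r * f = f * geo_scal r.
Proof. by rewrite geo_scalE /geo_scal -[RHS]geo_mulZr geo_mul1r. Qed.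

Fact geo_scal_nmod : nmod_morphism geo_scal.
Proof.
by split=> [|r s]; rewrite /geo_scal; [exact: scale0r | exact: scalerDl].
Qed.

HB.instance Definition _ :=
  GRing.isNmodMorphism.Build R geo_alg geo_scal geo_scal_nmod.

Fact geo_scal_monoid : monoid_morphism geo_scal.
Proof.
split=> [|r s]; first exact: scale1r.
by rewrite geo_scalE /geo_scal scalerA.
Qed.

HB.instance Definition _ :=
  GRing.isMonoidMorphism.Build R geo_alg geo_scal geo_scal_monoid.

Definition geo_ralg : ralgebra R := @RAlgebra R geo_alg geo_scal geo_scalC.

Lemma bas_prod s t :
  bas s * bas t = if geodesic s t then bas (s * t)%g else 0.
Proof. exact: geo_mul_bas. Qed.

(* The span of the [s] with N(s) = i. *)
Definition geo_deg (i : nat) f : Prop :=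
  forall s, tlen s != i -> coord f s = 0.

Fact geo_deg_sum : direct_sum geo_deg.
Proof.
split.
- move=> i; split=> [s _|f g hf hg s si]; first exact: coord0.
  by rewrite coordD -scaleN1r coordZ hf // hg // mulr0 addr0.
- move=> f.
  exists (\max_(s : 'S_d) tlen s)%N.+1,
    (fun i => \sum_(s | tlen s == i) coord f s *: bas s); split.
    move=> i s si; rewrite big_mkcond coord_sum big1 // => t _.
    case: eqP => [ti|_]; last exact: coord0.
    rewrite coordZ coord_bas; case: eqP => [st|_]; last by rewrite mulr0.
    by case/eqP: si; rewrite st.
  rewrite [LHS]geo_decomp.
  rewrite (partition_big
    (fun s => inord (tlen s) : 'I_(\max_(s : 'S_d) tlen s)%N.+1) xpredT) //=.
  apply: eq_bigr => i _; apply: eq_bigl => s.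
  by rewrite -val_eqE /= inordK // ltnS leq_bigmax.
- move=> n f hf f0 i lin; apply: coordP => s; rewrite coord0.
  have [si|si] := eqVneq (tlen s) i; last exact: hf.
  have := congr1 (fun g => coord g s) f0.
  rewrite coord_sum coord0 (bigD1 (Ordinal lin)) //= big1 ?addr0 //.
  move=> j ji; apply: hf; rewrite si; apply: contra ji => /eqP ij.
  exact/eqP/val_inj.
Qed.

Fact geo_deg_scal r : geo_deg 0 (geo_scal r).
Proof.
move=> s s0; rewrite coordZ coord_bas; have [se|_] := eqVneq s 1%g.
  by rewrite se tlen1 in s0.
by rewrite mulr0.
Qed.

Fact geo_degM i j f g : geo_deg i f -> geo_deg j g -> geo_deg (i + j) (f * g).
Proof.
move=> hf hg u uij; rewrite coord_sum big1 // => s _.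
rewrite coord_sum big1 // => t _; rewrite coordZ.
have [si|/hf->] := eqVneq (tlen s) i; last by rewrite !mul0r.
have [tj|/hg->] := eqVneq (tlen t) j; last by rewrite mulr0 mul0r.
rewrite /bas_mul; case: ifP => [/eqP st|_]; last by rewrite coord0 mulr0.
rewrite coord_bas; have [ue|_] := eqVneq u (s * t)%g; last by rewrite mulr0.
by rewrite ue st si tj eqxx in uij.
Qed.

Lemma amod_scaleE (r : R) (f : geo_alg) :
  r *: (f : amod geo_ralg) = r *: f :> geo_alg.
Proof. exact: geo_scalE. Qed.

Lemma coord_comb (I : Type) (s : seq I) (c : I -> R) (e : I -> amod geo_ralg) t :
  coord (\sum_(i <- s) c i *: e i) t = \sum_(i <- s) c i * coord (e i) t.
Proof.
by rewrite coord_sum; apply: eq_bigr => i _; rewrite amod_scaleE coordZ.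
Qed.

Fact geo_deg_free i :
  fg_free_mod (geo_deg i : amod geo_ralg -> Prop) (@zero_sub (amod geo_ralg)).
Proof.
pose I := {s : 'S_d | tlen s == i}.
exists #|{: I}|, (fun k => bas (val (enum_val k))); split.
- move=> k s si; rewrite coord_bas.
  have [se|//] := eqVneq s (val (enum_val k)).
  by rewrite se (valP (enum_val k)) in si.
- move=> f hf; exists (enum 'I_#|{: I}|), (fun k => coord f (val (enum_val k))).
  apply/eqP; rewrite subr_eq0; apply/eqP/coordP => s.
  rewrite coord_comb big_enum /=.
  have [si|si] := boolP (tlen s == i).
    rewrite (bigD1 (enum_rank (Sub s si : I))) //= enum_rankK /= big1.
      by rewrite coord_bas eqxx mulr1 addr0.
    move=> k hk; rewrite coord_bas; case: eqP => [sk|_]; last by rewrite mulr0.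
    case/eqP: hk; apply/enum_val_inj; rewrite enum_rankK; exact/val_inj.
  rewrite hf // big1 // => k _; rewrite coord_bas.
  case: eqP => [sk|_]; last by rewrite mulr0.
  by case/negP: si; rewrite sk (valP (enum_val k)).
- move=> s c us E k ks.
  have := congr1 (fun g : geo_alg => coord g (val (enum_val k))) E.
  rewrite coord_comb coord0 (bigD1_seq k) //= big1.
    by rewrite coord_bas eqxx mulr1 addr0.
  move=> l lk; rewrite coord_bas; case: eqP => [kl|_]; last by rewrite mulr0.
  by case/eqP: lk; apply/enum_val_inj/val_inj.
Qed.

Definition geo_aug f : R := coord f 1.

Fact geo_aug_nmod : nmod_morphism geo_aug.
Proof. by split=> [|f g]; [exact: coord0 | exact: coordD]. Qed.

HB.instance Definition _ :=
  GRing.isNmodMorphism.Build geo_alg R geo_aug geo_aug_nmod.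

Fact geo_aug_monoid : monoid_morphism geo_aug.
Proof.
split=> [|f g]; first by rewrite /geo_aug coord_bas eqxx.
rewrite /geo_aug coord_sum (bigD1 1%g) //= coord_sum (bigD1 1%g) //=.
rewrite !big1 ?addr0.
- by rewrite coordZ /bas_mul geodesic1s mulg1 coord_bas eqxx mulr1.
- move=> s s1; rewrite coord_sum big1 // => t _; rewrite coordZ /bas_mul.
  case: ifP => [/eqP st|_]; last by rewrite coord0 mulr0.
  rewrite coord_bas; case: eqP => [st1|_]; last by rewrite mulr0.
  case/eqP: s1; apply: tlen0.
  by move/eqP: st; rewrite -st1 tlen1 eq_sym addn_eq0 => /andP[/eqP].
- move=> t t1; rewrite coordZ /bas_mul geodesic1s mul1g coord_bas eq_sym.
  by rewrite (negPf t1) mulr0.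
Qed.

HB.instance Definition _ :=
  GRing.isMonoidMorphism.Build geo_alg R geo_aug geo_aug_monoid.

Fact geo_aug_deg0 f : geo_deg 0 f -> f = geo_scal (geo_aug f).
Proof.
move=> hf; apply: coordP => s; rewrite coordZ coord_bas.
case: eqP => [->|s1]; first by rewrite mulr1.
by rewrite mulr0 hf //; apply/eqP => /tlen0.
Qed.

Fact geo_aug_scal (r : R) : geo_aug (geo_scal r) = r.
Proof. by rewrite /geo_aug coordZ coord_bas eqxx mulr1. Qed.

Fact geo_aug_pos i f : (0 < i)%N -> geo_deg i f -> geo_aug f = 0.
Proof. by move=> i0 hf; apply: hf; rewrite tlen1 eq_sym -lt0n. Qed.

Definition geo_galg : graded_algebra R :=
  @GradedAlgebra R geo_ralg geo_deg geo_deg_sum geo_degM geo_deg_scal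
    geo_deg_free geo_aug geo_aug_scal geo_aug_deg0 geo_aug_pos.

End GeodesicAlgebra.

(* Main.v *)
(* The height of a permutation is the largest point that it moves.  Every s <> 1
   is uniquely t x with x a transposition and height t < height x, and then
   N(s) = N(t) + 1.  Hence the words in transpositions with strictly increasing
   heights represent the basis elements [s], each exactly once, and such a word
   is recognised by its two-letter subwords.  Rewriting to these normal forms
   uses quadratic relations only.

   For Koszulness, let a chain be a word in transpositions with weakly
   decreasing heights, so that no two-letter subword of it is in normal form,
   and let the j-th term of the resolution be the free module on the chains of
   length j.  Moving the last letter of s to the front of the chain gives a
   homotopy [s t] (x) c |-> [s] (x) t c; the differential is built from it by
   recursion, as in Anick's resolution.  The resolution is linear, hence
   minimal, and Ext^j is free on the chains of length j, in degree j. *)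
Require Import Defs.
From HB Require Import structures.
From mathcomp Require Import all_boot all_order all_algebra all_fingroup.
From mathcomp Require Import boolp functions zify.
Set Implicit Arguments.
Unset Strict Implicit.
Unset Printing Implicit Defensive.
(* all_algebra shadows coord with the coordinate function of vector.v. *)
Import Defs GRing.Theory.

(** * Heights of permutations, and transposition length as a cycle count *)

Section Permutations.
Import GroupScope.
Variable d : nat.
Implicit Types (s t w x y : 'S_d).

(* The points of 'I_d are counted from 1; the identity has height 0. *)
Definition height s : nat := \max_(i | s i != i) i.+1.

Lemma height_leP s b :
  reflect (forall i : 'I_d, b <= i -> s i = i) (height s <= b).
Proof.
apply: (iffP (bigmax_leqP _ _ _)) => [H i bi|H i]; last first.
  by apply: contraR; rewrite -leqNgt => /H ->.
by apply/eqP; apply: contraLR bi => /H; rewrite -ltnNge.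
Qed.

Lemma height1 : height 1 = 0%N.
Proof.
by apply/eqP; rewrite -leqn0; apply/height_leP => i _;
  rewrite perm1.
Qed.

Lemma height_fix s (i : 'I_d) : height s <= i -> s i = i.
Proof. by move=> h; apply: (height_leP _ _ (leqnn _)). Qed.

Lemma height_max s : s != 1 -> exists2 i : 'I_d, height s = i.+1 & s i != i.
Proof.
move=> s1; have [i si] : exists i, s i != i.
  apply/existsP; apply: contraR s1; rewrite negb_exists => /forallP H.
  by apply/eqP/permP => i; rewrite perm1; apply/eqP; rewrite -[_ == _]negbK.
have [|j sj e] := @eq_bigmax_cond _ [pred i | s i != i] (fun i : 'I_d => i.+1).
  by apply/card_gt0P; exists i.
by exists j; first exact: e.
Qed.

Lemma heightV s : height s^-1 = height s.
Proof.
have le t : height t^-1 <= height t.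
  by apply/height_leP => i /height_fix ti; rewrite -{1}ti permK.
by apply/eqP; rewrite eqn_leq le -{1}[s]invgK le.
Qed.

Lemma heightM s t : height (s * t) <= maxn (height s) (height t).
Proof.
apply/height_leP => i; rewrite geq_max => /andP[/height_fix si /height_fix ti].
by rewrite permM si ti.
Qed.

(** Since [t] is the product of [s^-1] and [s * t], the height of [s * t] cannot fall below that of
    [t]. *)
Lemma heightMr s t : height s < height t -> height (s * t) = height t.
Proof.
move=> st; have := heightM s t; have := heightM s^-1 (s * t).
by rewrite mulKg heightV; lia.
Qed.

Lemma tlen_tperm (a b : 'I_d) : a != b -> tlen (tperm a b) = 1%N.
Proof.
move=> ab; apply/eqP; rewrite eqn_leq; apply/andP; split.
  apply/tlen_min/is_tperm_prodP; exists [:: (a, b)].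
  by rewrite /= big_seq1 /dpair /= ab.
rewrite lt0n; apply: contra ab => /eqP/tlen0/permP/(_ a).
by rewrite tpermL perm1 => ->.
Qed.

Lemma height_tperm (a b : 'I_d) : a < b -> height (tperm a b) = b.+1.
Proof.
move=> ab; apply/eqP; rewrite eqn_leq; apply/andP; split.
  by apply/height_leP => i bi; rewrite tpermD //; apply/eqP => e; move: ab bi;
    rewrite e; lia.
rewrite ltnNge; apply/negP => /height_fix; rewrite tpermR => e.
by rewrite e ltnn in ab.
Qed.

Lemma tlen1P x : tlen x = 1%N -> exists a b : 'I_d, a < b /\ x = tperm a b.
Proof.
move=> x1; have := tlenP x; rewrite x1 => /is_tperm_prodP[ts].
case: ts => [|[a b] [|p ts]]; case=> // _.
rewrite /= andbT big_seq1 /dpair /= => ab ->.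
have [lt|lt|/val_inj e] := ltngtP a b; [by exists a, b| by exists b, a;
  rewrite tpermC|].
by rewrite e eqxx in ab.
Qed.

Lemma tlen1_inv x : tlen x = 1%N -> x * x = 1.
Proof. by case/tlen1P => a [b [_ ->]]; rewrite tperm2. Qed.

(** The identity has [d] cycles, and each transposition changes the number of cycles by one. *)
Lemma porbits_geq s m : is_tperm_prod s m -> d <= #|porbits s| + m.
Proof.
move=> /is_tperm_prodP[ts [<- + ->]]; elim: ts => [|[a b] ts IH] /=.
  move=> _; rewrite big_nil addn0 card_imset ?card_ord // => i j /setP/(_ j).
  by rewrite porbit_id => /porbitP[k]; rewrite expg1n perm1.
case/andP => ab /IH; rewrite big_cons /=.
move: (\prod_(_ <- ts) _) => p h.
have := porbits_mul_tperm p a b; rewrite /= (ab : a != b).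
move: h; set n := #|_|; set k := #|_|.
by case: (_ \notin _) => /=; lia.
Qed.

(** Let [b] be the largest moved point and [x] the transposition of [b] and [s b]. Points above [b]
    are fixed, so [s b < b], and [s * x] fixes [b] and everything above it. *)
Lemma height_decomp s : s != 1 ->
  exists t x, [/\ s = t * x, tlen x = 1%N & height t < height x].
Proof.
move=> /height_max[b mb sb].
have sbb : s b < b.
  rewrite ltn_neqAle sb leqNgt; apply/negP => lt.
  have := @height_fix s (s b); rewrite mb => /(_ lt)/perm_inj e.
  by rewrite e eqxx in sb.
exists (s * tperm (s b) b), (tperm (s b) b).
rewrite -mulgA tperm2 mulg1 tlen_tperm // height_tperm //; split=> //.
rewrite ltnS; apply/height_leP => i;
  rewrite leq_eqVlt => /predU1P[/val_inj <-|bi].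
  by rewrite permM tpermL.
by rewrite permM (@height_fix s i) ?mb // tpermD //; apply/eqP => e;
  move: sbb bi; rewrite e; lia.
Qed.

(** Equal products have equal heights, so [x] and [y] share their larger point [b]. Both [s] and [t]
    fix [b], so the product sends [b] to the smaller point of either transposition. *)
Lemma height_decomp_uniq s t x y : tlen x = 1%N -> tlen y = 1%N ->
  height s < height x -> height t < height y -> s * x = t * y -> s = t /\ x = y.
Proof.
move=> x1 y1 sx ty e; have exy : x = y; last by rewrite exy in e *;
  move/mulIg: e.
have := heightMr sx; rewrite e (heightMr ty) => mxy.
case/tlen1P: x1 => a [b [ab xE]]; case/tlen1P: y1 => a' [b' [ab' yE]].
move: mxy sx ty e; rewrite {}xE {}yE !height_tperm // => -[/val_inj ->].
rewrite !ltnS => /height_fix sb /height_fix tb /permP/(_ b).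
by rewrite !permM sb tb !tpermR => ->.
Qed.

(** The larger point of [x] is a cycle of [w] by itself, and multiplying by [x] merges it with
    another cycle. *)
Lemma porbits_tperm_fix w x : tlen x = 1%N -> height w < height x ->
  #|porbits (x * w)|.+1 = #|porbits w|.
Proof.
move=> /tlen1P[a [b [ab ->]]]; rewrite height_tperm // ltnS => /height_fix wb.
have := porbits_mul_tperm w a b.
have -> : a != b by apply/eqP => e; rewrite e ltnn in ab.
have -> : a \notin porbit w b.
  apply/negP => /porbitP[k]; have -> : (w ^+ k) b = b.
    by elim: k => [|k IH]; rewrite ?expg0 ?perm1 // expgSr permM IH.
  by move=> e; rewrite e ltnn in ab.
by rewrite /=; set n := #|_|; set k := #|_|; lia.
Qed.

Lemma porbits_tperm_fixr w x : tlen x = 1%N -> height w < height x ->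
  #|porbits (w * x)|.+1 = #|porbits w|.
Proof.
move=> x1 wx; rewrite -(porbitsV (w * x)) -(porbitsV w) invMg.
have -> : x^-1 = x by apply: (mulgI x); rewrite mulgV tlen1_inv.
by rewrite porbits_tperm_fix // heightV.
Qed.

(** One inequality is [porbits_geq]. For the other, induct on the height: passing from [t] to
    [s = t * x] adds at most one to the length and removes exactly one cycle. *)
Lemma tlen_porbits s : tlen s + #|porbits s| = d.
Proof.
apply/eqP; rewrite eqn_leq andbC addnC porbits_geq ?tlenP //=.
elim/ltn_ind: {s}(height s) {-2}s (erefl (height s)) => n IH s ns.
have [->|/height_decomp[t [x [sE x1 tx]]]] := eqVneq s 1.
  by rewrite tlen1 addn0 (leq_trans (leq_imset_card _ _)) ?card_ord.
have := IH (height t) _ t erefl; rewrite -ns {1}sE heightMr // => /(_ tx).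
have := tlenM t x; have := porbits_tperm_fixr x1 tx; rewrite -sE x1.
set n1 := #|_|; set n2 := #|_|; lia.
Qed.

Lemma geodesic_lt w x : tlen x = 1%N -> height w < height x -> geodesic w x.
Proof.
move=> x1 wx; rewrite /geodesic x1; have := porbits_tperm_fixr x1 wx.
by have := tlen_porbits w; have := tlen_porbits (w * x); lia.
Qed.

Lemma geodesic_gt w x : tlen x = 1%N -> height w < height x -> geodesic x w.
Proof.
move=> x1 wx; rewrite /geodesic x1; have := porbits_tperm_fix x1 wx.
by have := tlen_porbits w; have := tlen_porbits (x * w); lia.
Qed.

(** If the height dropped, [x] times [x * y] would be geodesic by [geodesic_gt]; but that product is
    [y], which is shorter than [x * y]. *)
Lemma height_geodesic x y : tlen x = 1%N -> height y <= height x ->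
  geodesic x y -> height (x * y) = height x.
Proof.
move=> x1 yx /eqP gxy; have := heightM x y.
have [lt _|//] := ltnP (height (x * y)) (height x); last by lia.
have := geodesic_gt x1 lt.
by rewrite /geodesic mulgA tlen1_inv // mul1g gxy x1; lia.
Qed.

Lemma height_tlen1 x : tlen x = 1%N -> 1 < height x.
Proof. by case/tlen1P => a [b [ab ->]]; rewrite height_tperm //; lia. Qed.

End Permutations.

(** * Chains of transpositions *)

Section Chains.
Local Open Scope ring_scope.
Variable d : nat.
Implicit Types (s t x y : 'S_d).

(* The value 1 at the empty word makes [height s < hheight w] say that s is
   the identity when w is empty. *)
Definition hheight (w : seq 'S_d) : nat :=
  if w is x :: _ then height x else 1%N.

Fixpoint is_chain (w : seq 'S_d) : bool :=
  if w is x :: w' then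
    [&& tlen x == 1%N, (hheight w' <= height x)%N & is_chain w']
  else true.

Definition chain (j : nat) : Type := {w : j.-tuple 'S_d | is_chain w}.
HB.instance Definition _ j :=
  Finite.copy (chain j) {w : j.-tuple 'S_d | is_chain w}.

Definition chead j (w : chain j.+1) : 'S_d := thead (val w).

Fact ctail_proof j (w : chain j.+1) : is_chain (behead_tuple (val w)).
Proof. by case: w => w /=; case/tupleP: w => x w /= /and3P[]. Qed.

Definition ctail j (w : chain j.+1) : chain j :=
  exist _ (behead_tuple (val w)) (ctail_proof w).

Lemma chain_ext j (u v : chain j.+1) : chead u = chead v ->
  ctail u = ctail v -> u = v.
Proof.
move=> hE /(congr1 val)/(congr1 val) /= bE; apply/val_inj/val_inj => /=.
move: hE bE; rewrite /chead; case: u => u /= _; case: v => v /= _.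
by case/tupleP: u => x u; case/tupleP: v => y v; rewrite !theadE /= => -> ->.
Qed.

Lemma cheadP j (w : chain j.+1) :
  tlen (chead w) = 1%N /\ (hheight (val (ctail w)) <= height (chead w))%N.
Proof.
rewrite /chead; case: w => w /=; case/tupleP: w => x w /= /and3P[/eqP h1 h2 _].
by rewrite theadE.
Qed.

Lemma hheightE j (w : chain j.+1) : hheight (val w) = height (chead w).
Proof.
by rewrite /chead; case: w => w /= _; case/tupleP: w => x w;
  rewrite theadE.
Qed.

Lemma chain_cons j x (c : chain j) : tlen x = 1%N ->
  (hheight (val c) <= height x)%N ->
  exists w : chain j.+1, chead w = x /\ ctail w = c.
Proof.
move=> x1 cx; pose u := [tuple of x :: val c]; have h : is_chain u.
  by rewrite /= x1 cx (valP c).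
exists (exist (fun w : j.+1.-tuple _ => is_true (is_chain w)) u h);
  rewrite /chead /= theadE; split=> //.
by apply/val_inj/val_inj.
Qed.

Definition chain_nil : chain 0 := exist _ [tuple] isT.

Lemma chain0E (c : chain 0) : c = chain_nil.
Proof. by apply/val_inj/val_inj; case: c => c /= _; rewrite (tuple0 c). Qed.

End Chains.

(** * Free modules on chains, the contracting homotopy and the exact differential *)

Section Resolution.
Local Open Scope ring_scope.
Variables (R : comPzRingType) (d : nat).
Notation A := (geo_alg R d).
Notation chain := (chain d).
Implicit Types (s t x y : 'S_d).

Definition resol (j : nat) := {ffun chain j -> A^o}.
HB.instance Definition _ j :=
  GRing.Lmodule.copy (resol j) {ffun chain j -> A^o}.

Definition rcoef j (v : resol j) (c : chain j) : A :=
  (v : {ffun chain j -> A^o}) c.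

Lemma rcoefD j (u v : resol j) c : rcoef (u + v) c = rcoef u c + rcoef v c.
Proof. by rewrite /rcoef ffunE. Qed.

Lemma rcoefN j (v : resol j) c : rcoef (- v) c = - rcoef v c.
Proof. by rewrite /rcoef ffunE. Qed.

Lemma rcoefZ j a (v : resol j) c : rcoef (a *: v) c = a * rcoef v c.
Proof. by rewrite /rcoef ffunE. Qed.

Lemma rcoef0 j c : rcoef (0 : resol j) c = 0.
Proof. by rewrite /rcoef ffunE. Qed.

Lemma rcoef_sum j (I : Type) (r : seq I) (Q : pred I) (F : I -> resol j) c :
  rcoef (\sum_(i <- r | Q i) F i) c = \sum_(i <- r | Q i) rcoef (F i) c.
Proof. by elim/big_rec2: _ => [|i x y _ <-]; rewrite ?rcoef0 ?rcoefD. Qed.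

Lemma coordN (f : A) s : coord (- f) s = - coord f s.
Proof. by rewrite /coord ffunE. Qed.

Lemma resol_ext j (u v : resol j) :
  (forall c s, coord (rcoef u c) s = coord (rcoef v c) s) -> u = v.
Proof. by move=> h; apply/ffunP => c; apply: coordP => s; apply: h. Qed.

Definition mono j (r : R) s (c : chain j) : resol j :=
  [ffun c' => if c' == c then r *: bas R s else 0].

Lemma coord_mono j r s (c : chain j) c' s' :
  coord (rcoef (mono r s c) c') s' = if (c' == c) && (s' == s) then r else 0.
Proof.
rewrite /rcoef ffunE; case: (c' == c) => /=; last exact: coord0.
by rewrite coordZ coord_bas; case: (s' == s); rewrite ?mulr1 ?mulr0.
Qed.

(** The R-span of the [s] (x) c with [Q s c]. Degrees and height bounds are all stated in this form,
    so that [supp_ind] reduces them to basis elements. *)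
Definition supp j (Q : 'S_d -> chain j -> bool) (v : resol j) : Prop :=
  forall c s, ~~ Q s c -> coord (rcoef v c) s = 0.

Lemma suppD j Q (u v : resol j) : supp Q u -> supp Q v -> supp Q (u + v).
Proof. by move=> hu hv c s q; rewrite rcoefD coordD hu ?hv ?addr0. Qed.

Lemma suppB j Q (u v : resol j) : supp Q u -> supp Q v -> supp Q (u - v).
Proof.
by move=> hu hv c s q;
  rewrite rcoefD rcoefN coordD coordN hu ?hv ?subr0.
Qed.

Lemma supp0 j Q : supp Q (0 : resol j).
Proof. by move=> c s _; rewrite rcoef0 coord0. Qed.

Lemma supp_mono j (Q : 'S_d -> chain j -> bool) r s (c : chain j) : Q s c ->
  supp Q (mono r s c).
Proof.
move=> q c' s' q'; rewrite coord_mono; case: andP => // -[/eqP ec /eqP es].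
by rewrite -ec -es (negPf q') in q.
Qed.

Lemma mono_decomp j (v : resol j) :
  v = \sum_c \sum_s mono (coord (rcoef v c) s) s c.
Proof.
apply: resol_ext => c s; rewrite rcoef_sum coord_sum (bigD1 c) //= rcoef_sum
  coord_sum.
rewrite (bigD1 s) //= coord_mono !eqxx /= !big1 ?addr0 // => [c' c'c|s' s's].
  rewrite rcoef_sum coord_sum big1 // => s' _.
  by rewrite coord_mono eq_sym (negPf c'c).
by rewrite coord_mono eqxx eq_sym (negPf s's).
Qed.

Lemma mono0 j s (c : chain j) : mono 0 s c = 0.
Proof.
by apply: resol_ext => c' s';
  rewrite coord_mono rcoef0 coord0 if_same.
Qed.

Lemma supp_ind j (Q : 'S_d -> chain j -> bool) (K : resol j -> Prop) : K 0 ->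
  (forall u v, K u -> K v -> K (u + v)) ->
  (forall r s c, Q s c -> K (mono r s c)) -> forall v, supp Q v -> K v.
Proof.
move=> K0 KD Km v hv; rewrite [v]mono_decomp.
elim/big_ind: _ => // c _; elim/big_ind: _ => // s _.
have [/Km //|/hv ->] := boolP (Q s c).
by rewrite mono0.
Qed.

Lemma mul_scale_bas r r' s s' :
  (r *: bas R s) * (r' *: bas R s') = (r * r') *: bas_mul R s s' :> A.
Proof. by rewrite -[LHS]geo_mulZl -geo_mulZr scalerA geo_mul_bas. Qed.

Lemma scale_mono j r r' s s' (c : chain j) :
  (r *: bas R s : A) *: mono r' s' c =
  if geodesic s s' then mono (r * r') (s * s')%g c else 0.
Proof.
apply: resol_ext => c' t; rewrite rcoefZ {1}/rcoef ffunE.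
case: (altP (c' =P c)) => [->|cc]; last first.
  rewrite mulr0 coord0; case: ifP => _; last by rewrite rcoef0 coord0.
  by rewrite coord_mono (negPf cc).
rewrite mul_scale_bas /bas_mul.
case: ifP => _; last by rewrite rcoef0 scaler0 coord0.
by rewrite coord_mono eqxx coordZ coord_bas /=; case: eqP;
  rewrite ?mulr1 ?mulr0.
Qed.

Lemma supp_scale j (Q Q' : 'S_d -> chain j -> bool) r x v :
  (forall s c, Q s c -> geodesic x s -> Q' (x * s)%g c) ->
  supp Q v -> supp Q' ((r *: bas R x : A) *: v).
Proof.
move=> QQ'; apply: (@supp_ind _ Q (fun v =>
  supp Q' ((r *: bas R x : A) *: v))); first by rewrite scaler0; apply: supp0.
  by move=> u w hu hw; rewrite scalerDr; apply: suppD.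
move=> r' s c q; rewrite scale_mono; case: ifP => [g|_]; last exact: supp0.
exact/supp_mono/QQ'.
Qed.

(* Contracting homotopy: [s x] (x) c goes to [s] (x) x c when x is the last
   letter of the normal form of s x and x c is a chain, and the remaining
   basis elements, the allowed ones below, go to 0. *)
Definition peel j (v : resol j) : resol j.+1 :=
  [ffun w : chain j.+1 => [ffun s : 'S_d =>
    if (height s < height (chead w))%N
    then coord (rcoef v (ctail w)) (s * chead w)%g else 0] : A].

Lemma coord_peel j (v : resol j) w s : coord (rcoef (peel v) w) s =
  if (height s < height (chead w))%N
  then coord (rcoef v (ctail w)) (s * chead w)%g else 0.
Proof. by rewrite /rcoef ffunE /coord ffunE. Qed.

Lemma peelD j (u v : resol j) : peel (u + v) = peel u + peel v.
Proof.
apply: resol_ext => w s; rewrite rcoefD coordD !coord_peel rcoefD coordD.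
by case: ifP; rewrite ?addr0.
Qed.

Lemma peelN j (v : resol j) : peel (- v) = - peel v.
Proof.
apply: resol_ext => w s; rewrite rcoefN coordN !coord_peel rcoefN coordN.
by case: ifP; rewrite ?oppr0.
Qed.

Lemma peel0 j : peel (0 : resol j) = 0.
Proof.
by apply: resol_ext => w s;
  rewrite coord_peel !rcoef0 !coord0 if_same.
Qed.

Definition allowed j s (c : chain j) : bool := (height s < hheight (val c))%N.

Lemma peel_allowed j (v : resol j) : supp (@allowed j) v -> peel v = 0.
Proof.
move=> hv; apply: resol_ext => w s; rewrite coord_peel rcoef0 coord0.
case: ifP => // sw; apply: hv; have [_ hw] := cheadP w.
by rewrite /allowed heightMr // -leqNgt.
Qed.

Lemma peel_supp j (v : resol j) : supp (@allowed j.+1) (peel v).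
Proof. by move=> w s; rewrite /allowed hheightE coord_peel => /negPf->. Qed.

Lemma hheight_gt0 j (c : chain j) : (0 < hheight (val c))%N.
Proof.
case: j c => [|j] c; first by rewrite (chain0E c).
by rewrite hheightE; have [/height_tlen1] := cheadP c; lia.
Qed.

(** Converse of [peel_allowed]: if [s] (x) c is not allowed, then [s] is not 1 and its last letter
    can be put in front of [c], so [peel] sees the coefficient. *)
Lemma peel_eq0 j (v : resol j) : peel v = 0 -> supp (@allowed j) v.
Proof.
move=> hv c s; rewrite /allowed -leqNgt => cs.
have /height_decomp[t [x [sE x1 tx]]] : s != 1%g.
  by apply/eqP => s1; move: cs; rewrite s1 height1 leqNgt hheight_gt0.
move: cs; rewrite sE heightMr // => cs.
have [w [wx wc]] := chain_cons x1 cs.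
by have := coord_peel v w t; rewrite hv rcoef0 coord0 wx wc tx => <-.
Qed.

(** By uniqueness of the decomposition, only one coordinate of [peel] sees this basis element. *)
Lemma peel_mono j r s (w : chain j.+1) : (height s < height (chead w))%N ->
  peel (mono r (s * chead w)%g (ctail w)) = mono r s w.
Proof.
move=> sw; apply: resol_ext => w' s'; rewrite coord_peel !coord_mono.
have [w1 _] := cheadP w; have [w1' _] := cheadP w'.
case: ifP => [sw'|sw']; last first.
  case: andP => // -[/eqP ew /eqP es]; by rewrite ew es sw in sw'.
case: andP => [[/eqP ew /eqP /height_decomp_uniq es]|n]; last first.
  case: andP => // -[/eqP ew /eqP es]; by case: n; rewrite ew es !eqxx.
have [-> eh] := es w1' w1 sw' sw.
by rewrite (chain_ext eh ew) !eqxx.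
Qed.

Definition lin_ext j k (F : chain j -> resol k) (v : resol j) : resol k :=
  \sum_w rcoef v w *: F w.

(* The boundary of x c is [x] (x) c, corrected by the homotopy so that it
   becomes a cycle. *)
Fixpoint diff j : resol j.+1 -> resol j :=
  match j return resol j.+1 -> resol j with
  | 0 => lin_ext (fun w => mono 1 (chead w) (ctail w))
  | k.+1 => lin_ext (fun w =>
    mono 1 (chead w) (ctail w) - peel (diff (mono 1 (chead w) (ctail w))))
  end.

(** The correction in [diff], set to 0 at the bottom so that [diffE] is one formula for all
    degrees. *)
Definition corr j : chain j.+1 -> resol j :=
  match j return chain j.+1 -> resol j with
  | 0 => fun=> 0
  | k.+1 => fun w => peel (diff (mono 1 (chead w) (ctail w)))
  end.

Lemma diffE j (v : resol j.+1) :
  diff v = \sum_w rcoef v w *: (mono 1 (chead w) (ctail w) - corr w).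
Proof. by case: j v => [|j] v //=; apply: eq_bigr => w _; rewrite subr0. Qed.

Lemma diff_linear j : linear (@diff j).
Proof.
move=> a u v; rewrite !diffE scaler_sumr -big_split /=; apply: eq_bigr => w _.
by rewrite rcoefD rcoefZ scalerDl scalerA.
Qed.

HB.instance Definition _ j :=
  GRing.isLinear.Build _ _ _ _ (@diff j) (@diff_linear j).

Lemma diff_mono j r s (w : chain j.+1) :
  diff (mono r s w) =
  (r *: bas R s : A) *: (mono 1 (chead w) (ctail w) - corr w).
Proof.
rewrite diffE (bigD1 w) //= {1}/rcoef ffunE eqxx big1 ?addr0 // => w' w'w.
by rewrite /rcoef ffunE (negPf w'w) scale0r.
Qed.

(* The correction does not change the height of the leading letter: this makes
   [peel] an exact left inverse of [diff] on the allowed elements, with no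
   lower order terms to be cleared. *)
Lemma corr_supp j (w : chain j.+1) :
  supp (fun s c => (height s < hheight (val c))%N &&
    (hheight (val c) == height (chead w))) (corr w).
Proof.
elim: j w => [|j IH] w; first exact: supp0.
have [w1 hw] := cheadP w; rewrite hheightE in hw; move: hw;
  set c := ctail w => hw.
(* [peel] cuts off a last letter of the same height as the whole coefficient, so only the heights in
   the boundary matter. *)
suff h : supp (fun s _ =>
  height s == height (chead w)) (diff (mono 1 (chead w) c)).
  move=> w' s; rewrite /= coord_peel hheightE; case: ifP => //= sw' n.
  by apply: h; rewrite heightMr.
rewrite diff_mono; apply: (@supp_scale _ (fun s _ =>
  height s <= height (chead w))%N).
  by move=> s _ sw g; rewrite height_geodesic.
apply: suppB; first exact: supp_mono.
move=> c' s; rewrite -ltnNge => ws; apply: IH.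
by apply/negP => /andP[h1 /eqP h2]; lia.
Qed.

(** The leading term of the boundary peels back to the basis element, and the correction stays
    allowed, so [peel] kills it. *)
Lemma peel_diff j (v : resol j.+1) : supp (@allowed j.+1) v ->
  peel (diff v) = v.
Proof.
apply: (@supp_ind _ (@allowed j.+1) (fun v => peel (diff v) = v)).
- by rewrite linear0 peel0.
- by move=> u w; rewrite linearD peelD => -> ->.
move=> r s w; rewrite /allowed hheightE => sw; have [w1 _] := cheadP w.
rewrite diff_mono scalerBr scale_mono geodesic_lt // mulr1 peelD peelN
  peel_mono //.
(* Both [s] and the coefficients in [corr w] are lower than the heads of the chains in [corr w],
   hence so are their products. *)
rewrite (@peel_allowed _ (_ *: corr w)) ?subr0 //.
apply: supp_scale (@corr_supp _ w) => t c /andP[tc /eqP cw] _.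
by rewrite /allowed; have := heightM s t; lia.
Qed.

(** Degree 0 uses the augmentation, so that exactness of the augmented complex is a single
    statement. *)
Definition cycle_of j : resol j -> Prop :=
  match j return resol j -> Prop with
  | 0 => fun v => geo_aug (rcoef v (chain_nil d)) = 0
  | k.+1 => fun v => diff v = 0
  end.

Lemma cycle_ofB j (u v : resol j) : cycle_of u -> cycle_of v ->
  cycle_of (u - v).
Proof.
case: j u v => [|j] u v /= hu hv; last by rewrite linearB /= hu hv subr0.
by rewrite rcoefD rcoefN raddfB /= hu hv subr0.
Qed.

(** In positive degree [peel] inverts [diff] on allowed elements. In degree 0 only [1] is allowed,
    and the augmentation reads its coefficient. *)
Lemma cycle_of_allowed j (v : resol j) : supp (@allowed j) v -> cycle_of v ->
  v = 0.
Proof.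
case: j v => [|j] v hv /= cv; last by rewrite -(peel_diff hv) cv peel0.
apply: resol_ext => c s; rewrite (chain0E c) rcoef0 coord0.
have [->|s1] := eqVneq s 1%g; first exact: cv.
apply: hv; rewrite /allowed /= ltnS leqn0.
by have [b -> _] := height_max s1.
Qed.

(** The difference [z - diff (peel z)] is a cycle killed by [peel], hence allowed, hence zero. The
    hypothesis lets this serve inside the induction for [diff_cycle]. *)
Lemma cycle_of_boundary j : (forall v : resol j.+1, cycle_of (diff v)) ->
  forall z : resol j, cycle_of z -> z = diff (peel z).
Proof.
move=> B z cz; apply/eqP; rewrite -subr_eq0; apply/eqP.
apply: cycle_of_allowed; last exact: cycle_ofB.
by apply: peel_eq0; rewrite peelD peelN peel_diff ?subrr //; apply: peel_supp.
Qed.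

(** A generator has boundary [z - peel (diff z)], and [diff z] is a cycle by induction, so
    [cycle_of_boundary] gives [diff (peel (diff z)) = diff z]. At the bottom, letters have positive
    length and augment to 0. *)
Lemma diff_cycle j (v : resol j.+1) : cycle_of (diff v).
Proof.
elim: j v => [|j IH] v; rewrite diffE.
  rewrite /= rcoef_sum raddf_sum big1 //= => w _.
  rewrite subr0 rcoefZ rmorphM /= (_ :
    geo_aug (rcoef (mono _ _ _) _) = 0) ?mulr0 //.
  rewrite /geo_aug coord_mono; case: andP => // -[_ /eqP w1].
  by have [] := cheadP w; rewrite -w1 tlen1.
rewrite /= linear_sum big1 // => w _; rewrite linearZ /= linearB /=.
by rewrite -(cycle_of_boundary IH (IH _)) subrr scaler0.
Qed.

Lemma cycle_ofP j (z : resol j) : cycle_of z <-> exists v, diff v = z.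
Proof.
split=> [cz|[v <-]]; last exact: diff_cycle.
by exists (peel z); rewrite -(cycle_of_boundary (@diff_cycle j) cz).
Qed.

End Resolution.

(** * Internal grading, minimality of the resolution, and computation of Ext *)

Section Koszul.
Local Open Scope ring_scope.
Variables (R : comPzRingType) (d : nat).
Notation A := (geo_galg R d).
Notation chain := (chain d).
Notation resol := (resol R d).
Implicit Types (s t x y : 'S_d).

(** A chain of length [j] is placed in internal degree [j]; this makes the resolution linear. *)
Definition resol_deg j (i : nat) : resol j -> Prop :=
  supp (fun s _ => (tlen s + j == i)%N).

Fact resol_deg_sum j : direct_sum (@resol_deg j).
Proof.
split.
- by move=> i; split=> [|u v]; [apply: supp0 | apply: suppB].
- move=> v; pose N := (\max_(s : 'S_d) tlen s + j)%N.
  exists N.+1, (fun i =>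
    \sum_c \sum_(s | (tlen s + j == i)%N) mono (coord (rcoef v c) s) s c).
  split=> [i|].
    elim/big_ind: _ => [|u w|c _]; [exact: supp0 | exact: suppD |].
    by elim/big_ind: _ => [|u w|s si];
      [exact: supp0 | exact: suppD | exact: supp_mono].
  rewrite {1}[v]mono_decomp [RHS]exchange_big /=; apply: eq_bigr => c _.
  rewrite (partition_big (fun s => inord (tlen s + j) : 'I_N.+1) xpredT) //=.
  apply: eq_bigr => i _; apply: eq_bigl => s.
  by rewrite -val_eqE /= inordK // ltnS leq_add2r leq_bigmax.
- move=> n f hf f0 i lin; apply: resol_ext => c s; rewrite rcoef0 coord0.
  have [si|si] := eqVneq (tlen s + j)%N i; last exact: hf.
  have := congr1 (fun v => coord (rcoef v c) s) f0.
  rewrite rcoef_sum coord_sum rcoef0 coord0 (bigD1 (Ordinal lin)) //= big1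
    ?addr0 //.
  move=> k ki; apply: hf; rewrite si; apply: contra ki => /eqP ik.
  exact/eqP/val_inj.
Qed.

Fact resol_degZ j i k (a : A) (v : resol j) : gdeg i a -> resol_deg k v ->
  resol_deg (i + k) (a *: v : resol j).
Proof.
move=> ha hv; rewrite [a]geo_decomp scaler_suml.
elim/big_ind: _ => [|u w|s _]; [exact: supp0 | exact: suppD |].
have [si|/ha ->] := eqVneq (tlen s) i; last by rewrite !scale0r; apply: supp0.
apply: supp_scale hv => t c /eqP tk /eqP ->; by apply/eqP; lia.
Qed.

Definition resol_mod j : graded_module A :=
  @GradedModule R A (resol j) (@resol_deg j) (@resol_deg_sum j) (@resol_degZ j).

Definition rgen j (c : chain j) : resol j := mono 1 1%g c.

Lemma scale_rgen j (a : geo_alg R d) (c c' : chain j) :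
  rcoef (a *: rgen c) c' = if c' == c then a else 0.
Proof.
rewrite rcoefZ /rcoef ffunE; case: ifP => _; last by rewrite mulr0.
by rewrite scale1r mulr1.
Qed.

Lemma rgen_decomp j (v : resol j) : v = \sum_c rcoef v c *: rgen c.
Proof.
apply: resol_ext => c s; rewrite rcoef_sum (bigD1 c) //= scale_rgen eqxx big1
  ?addr0 //.
by move=> c' c'c; rewrite scale_rgen eq_sym (negPf c'c).
Qed.

Lemma resol_free j : graded_free (resol_mod j).
Proof.
exists (chain j), (@rgen j), (fun=> j); split=> [c|].
  by apply: supp_mono; rewrite tlen1.
split=> // [v _|s k us k0 c cs].
  exists (enum {: chain j}), (rcoef v); rewrite /zero_sub big_enum /=.
  by rewrite {1}[v]rgen_decomp subrr.
have := congr1 (fun v => rcoef v c) k0.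
rewrite rcoef_sum rcoef0 (bigD1_seq c) //= scale_rgen eqxx big1 ?addr0 //.
by move=> c' c'c; rewrite scale_rgen eq_sym (negPf c'c).
Qed.

(** The product [s * chead w] is geodesic, so the unit of length lost by the coefficient is gained
    by the chain. *)
Lemma peel_deg j i (v : resol j) : resol_deg i v -> resol_deg i (peel v).
Proof.
move=> hv w s si; rewrite coord_peel; case: ifP => // sw; apply: hv.
have [w1 _] := cheadP w; have /eqP := geodesic_lt w1 sw; rewrite w1 => ->.
by rewrite -addnA.
Qed.

Lemma diff_deg j i (v : resol j.+1) : resol_deg i v -> resol_deg i (diff v).
Proof.
elim: j i v => [|j IH] i v;
  apply: (@supp_ind _ _ _ _ (fun v => resol_deg i (diff v))).
- by rewrite linear0; apply: supp0.
- by move=> u w hu hw; rewrite linearD; apply: suppD.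
- move=> r s w /eqP si; have [w1 _] := cheadP w;
  rewrite diff_mono subr0 scale_mono.
  case: ifP => [/eqP g|_]; last exact: supp0.
  by apply: supp_mono; rewrite g w1 -addnA si.
- by rewrite linear0; apply: supp0.
- by move=> u w hu hw; rewrite linearD; apply: suppD.
- move=> r s w /eqP si; have [w1 _] := cheadP w; rewrite diff_mono.
  have h : resol_deg j.+2 (mono 1 (chead w) (ctail w)) by apply: supp_mono;
    rewrite w1.
  apply: supp_scale (suppB h (peel_deg (IH _ _ h))) => t c /eqP tj /eqP ->.
  by apply/eqP; lia.
Qed.

Definition aug (v : resol_mod 0) : trivmod_at A 0 :=
  geo_aug (rcoef v (chain_nil d)).

Fact aug_linear : linear aug.
Proof.
by move=> a u v; rewrite /aug rcoefD rcoefZ raddfD /= rmorphM.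
Qed.
HB.instance Definition _ := GRing.isLinear.Build _ _ _ _ aug aug_linear.

Fact aug_deg : degree_preserving aug.
Proof.
move=> i v hv; have [->|i0] := eqVneq i 0%N; first by left.
by right; apply: hv; rewrite tlen1 eq_sym.
Qed.

Fact aug_surj r : exists v, aug v = r.
Proof.
exists (mono r 1%g (chain_nil d)).
by rewrite /aug /geo_aug coord_mono !eqxx.
Qed.

Definition diff_lin j : {linear resol_mod j.+1 -> resol_mod j} :=
  GRing.Linear.clone _ _ _ _ (@diff R d j : resol_mod j.+1 -> resol_mod j) _.

Definition resolution : graded_free_resolution A :=
  @GradedFreeResolution R A resol_mod resol_free diff_lin aug
    (fun j => @diff_deg j) aug_deg aug_surj (@cycle_ofP R d 0)
    (fun j => @cycle_ofP R d j.+1).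

Lemma hom_decomp j (f : cochain resolution j) v : ext_hom f ->
  f v = \sum_c geo_aug (rcoef (v : resol j) c) * f (rgen c).
Proof.
move=> fl; pose F := GRing.isLinear.Build _ _ _ _ (f : resolution j ->
  trivmod A) fl.
pose g : {linear resolution j -> trivmod A} :=
  HB.pack (f : resolution j -> trivmod A) F.
rewrite {1}[v]rgen_decomp; rewrite -[LHS]/(g _) linear_sum.
by apply: eq_bigr => c _; rewrite linearZ.
Qed.

(** Minimality: boundaries from level [j.+1] live in degrees at least [j.+1], while [1] on a chain
    of length [j] has degree [j]. Hence all cochain differentials vanish. *)
Lemma aug_diff j (v : resol j.+1) c : geo_aug (rcoef (diff v) c) = 0.
Proof.
apply: (@supp_ind _ _ _ (fun _ _ => true) (fun v =>
  geo_aug (rcoef (diff v) c) = 0)) => //.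
- by rewrite linear0 rcoef0 raddf0.
- by move=> u w hu hw; rewrite linearD rcoefD raddfD /= hu hw addr0.
move=> r s w _; have h : resol_deg (tlen s + j.+1) (mono r s w) by apply:
  supp_mono.
by apply: (diff_deg h); rewrite tlen1; apply/eqP; lia.
Qed.

Lemma hom_diff j (f : cochain resolution j) : ext_hom f -> ext_d f = 0.
Proof.
move=> fl; apply/funext => v; rewrite /ext_d (hom_decomp _ fl) big1 // => c _.
by rewrite aug_diff mul0r.
Qed.

Lemma hom0 j : ext_hom (0 : cochain resolution j).
Proof. by move=> a u v; rewrite [RHS]addr0 [RHS]mulr0. Qed.

Lemma coboundary0 j (f : cochain resolution j) : ext_coboundary f <-> f = 0.
Proof.
case: j f => [|j] f //; split=> [[g gl ->]|->]; first exact: hom_diff.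
by exists 0; [exact: (@hom0 _) | rewrite (hom_diff (@hom0 j))].
Qed.

(** All generators sit in degree [j], so a graded map to R placed in another degree kills them. *)
Lemma hom_degP j nu (f : cochain resolution j) : ext_hom f ->
  ext_hom_deg nu f <-> nu = j \/ f = 0.
Proof.
move=> fl; split=> [[_ fd]|[->|->]].
- have [->|nuj] := eqVneq nu j; [by left | right].
  apply/funext => v; rewrite (hom_decomp _ fl) big1 // => c _.
  case: (fd j (rgen c)) => [|e|->]; last by rewrite mulr0.
    by apply: supp_mono; rewrite tlen1.
  by rewrite e eqxx in nuj.
- split=> // i v hv; have [->|ij] := eqVneq i j; [by left | right].
  rewrite (hom_decomp _ fl) big1 // => c _.
  rewrite (_ : geo_aug _ = 0) ?mul0r //.
  by apply: hv; rewrite tlen1 eq_sym.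
- by split=> [|i v _]; [exact: (@hom0 _) | right].
Qed.

Definition dual_rgen j (c : chain j) : cochain resolution j :=
  fun v => geo_aug (rcoef (v : resol j) c).

Lemma dual_rgen_hom j (c : chain j) : ext_hom (dual_rgen c).
Proof. by move=> a u v; rewrite /dual_rgen rcoefD rcoefZ raddfD /= rmorphM. Qed.

Lemma ext_fg_freeP j : ext_fg_free resolution j.
Proof.
exists #|{: chain j}|, (fun k => dual_rgen (enum_val k)); split.
- by move=> k; split; [apply: dual_rgen_hom | apply/hom_diff/dual_rgen_hom].
- move=> f [fl _]; exists (enum 'I_#|{: chain j}|), (fun k =>
  f (rgen (enum_val k))).
  apply/coboundary0/funext => v; rewrite -[LHS]/(f v - _) fct_sumE.
  apply/eqP; rewrite subr_eq0; apply/eqP; rewrite (hom_decomp _ fl).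
  rewrite big_enum /= (reindex_onto enum_val enum_rank) => [|c _];
    last exact: enum_rankK.
  apply: eq_big => [k|k _]; first by rewrite enum_valK eqxx.
  by rewrite mulrC.
- move=> s k us /coboundary0 k0 i si.
  have := congr1 (fun f => f (rgen (enum_val i))) k0.
  rewrite fct_sumE (bigD1_seq i) //= big1 => [|l li].
    rewrite addr0 => e; rewrite -[RHS]e -[RHS]/(k i * geo_aug _).
    by rewrite /geo_aug coord_mono !eqxx mulr1.
  rewrite -[LHS]/(k l * geo_aug _) /geo_aug coord_mono eqxx andbT.
  by rewrite (inj_eq enum_val_inj) (negPf li) mulr0.
Qed.

Lemma coboundary_deg0 j nu : ext_coboundary_deg nu (0 : cochain resolution j).
Proof.
case: j => [|j] //; exists 0; last by rewrite (hom_diff (@hom0 j)).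
by apply/(hom_degP _ (@hom0 j)); right.
Qed.

Lemma geo_koszul : koszul A.
Proof.
exists resolution => j; split; first exact: ext_fg_freeP.
split=> [nu f nuj [[fl fd] f0]|f _ /coboundary0 ->|f [fl f0]].
- case: (iffLR (hom_degP nu fl) (conj fl fd)) => // ->.
  exact: coboundary_deg0.
- exact: coboundary_deg0.
- exists f; last by rewrite subrr; apply/coboundary0.
  by split=> //; apply/(hom_degP _ fl); left.
Qed.

End Koszul.

(** * Rewriting words modulo a two-sided ideal *)

Section IdealWords.
Local Open Scope ring_scope.
Variables (R : comPzRingType) (I : choiceType) (K : ncpoly R I -> Prop).
Implicit Types (p q : ncpoly R I) (u v w : seq I) (r : R).

Lemma nccoef_cat p q w : nccoef (p ++ q) w = nccoef p w + nccoef q w.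
Proof. by rewrite /nccoef big_cat. Qed.

Lemma nccoef_cons r u p w :
  nccoef ((r, u) :: p) w = (if u == w then r else 0) + nccoef p w.
Proof. by rewrite /nccoef big_cons /=; case: ifP; rewrite ?add0r. Qed.

Lemma nccoef_nil w : nccoef ([::] : ncpoly R I) w = 0.
Proof. exact: big_nil. Qed.

Lemma ncideal_words p a b :
  ncideal K p -> ncideal K [seq (t.1, a ++ t.2 ++ b) | t <- p].
Proof.
move=> /(ncidealM [:: (1, a)] [:: (1, b)]); rewrite /ncmul.
rewrite allpairs1l allpairs1r -map_comp.
by rewrite (eq_map (_ : _ =1 fun t => (t.1, a ++ t.2 ++ b))) // => t /=;
  rewrite mul1r mulr1 catA.
Qed.

Lemma ncideal_trans r u v q :
  ncideal K [:: (r, u); (- r, v)] -> ncideal K ((r, v) :: q) ->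
  ncideal K ((r, u) :: q).
Proof.
move=> h1 h2; apply: (ncideal_eq _ (ncidealD h1 h2)) => w.
rewrite nccoef_cat !nccoef_cons nccoef_nil addr0 -addrA; congr (_ + _).
by rewrite addrA; case: ifP; rewrite ?addNr !add0r.
Qed.

Lemma ncideal_refl r u : ncideal K [:: (r, u); (- r, u)].
Proof.
apply: (ncideal_eq _ (ncideal0 K)) => w; rewrite !nccoef_cons nccoef_nil addr0.
by case: ifP; rewrite ?subrr ?addr0.
Qed.

End IdealWords.

(** * Normal forms of words and the quadratic presentation *)

Section Quadratic.
Local Open Scope ring_scope.
Variables (R : comPzRingType) (d : nat).
Notation A := (geo_galg R d).
Implicit Types (s : 'S_d) (r : R).

Definition letter : Type := {x : 'S_d | tlen x == 1%N}.
HB.instance Definition _ := Finite.copy letter {x : 'S_d | tlen x == 1%N}.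
Implicit Types (x y : letter) (w : seq letter).

Definition letter_perm x : 'S_d := val x.
Local Notation lp := letter_perm.

Lemma letter1 x : tlen (lp x) = 1%N. Proof. exact/eqP/(valP x). Qed.

Lemma letterP s : tlen s = 1%N -> exists x, lp x = s.
Proof.
by move/eqP => s1;
  exists (exist (fun s => is_true (tlen s == 1%N)) s s1).
Qed.

(** Increasing heights are expressed by comparing each letter with the product of the preceding
    ones, whose height is that of the last of them. *)
Inductive normal_form : 'S_d -> seq letter -> Prop :=
| NF1 : normal_form 1 [::]
| NFrcons s w x : normal_form s w -> (height s < height (lp x))%N ->
    normal_form (s * lp x)%g (rcons w x).

Lemma normal_form_ex s : exists w, normal_form s w.
Proof.
elim/ltn_ind: {s}(height s) {-2}s (erefl (height s)) => n IH s ns.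
have [->|/height_decomp[t [x' [sE x1 tx]]]] := eqVneq s 1%g.
  by exists [::]; apply: NF1.
have [x xE] := letterP x1; rewrite -xE in sE tx.
have [|w hw] := IH (height t) _ t erefl; first by rewrite -ns sE heightMr.
by exists (rcons w x); rewrite sE; apply: NFrcons.
Qed.

Lemma normal_form_uniq s w w' : normal_form s w -> normal_form s w' -> w = w'.
Proof.
have ne s1 x : (height s1 < height (lp x))%N -> (s1 * lp x)%g <> 1%g.
  by move=> h /(congr1 (@height d)); rewrite heightMr // height1; lia.
move=> h; elim: h w' => {s w} [|s w x hw IH sx] w' h'.
  by inversion h' as [|s0 w0 x0 _ h0 e]; last case: (ne _ _ h0 e).
inversion h' as [e|s0 w0 x0 hw0 h0 e]; first by case: (ne _ _ sx).
have [es /val_inj ->] := height_decomp_uniq (letter1 x0) (letter1 x) h0 sx e.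
by rewrite -(IH w0) // -es.
Qed.

Definition nf s : seq letter := sval (cid (normal_form_ex s)).

Lemma nfP s : normal_form s (nf s).
Proof. exact: (svalP (cid (normal_form_ex s))). Qed.

Lemma nf_rcons s x : (height s < height (lp x))%N ->
  nf (s * lp x)%g = rcons (nf s) x.
Proof. by move=> sx; apply: normal_form_uniq (nfP _) (NFrcons (nfP s) sx). Qed.

Definition wprod w : 'S_d := (\prod_(x <- w) lp x)%g.

Lemma wprod_rcons w x : wprod (rcons w x) = (wprod w * lp x)%g.
Proof. by rewrite /wprod -cats1 big_cat big_seq1. Qed.

(** Reduced words; by [eval_word] all others evaluate to 0. *)
Definition wgeo w : bool := tlen (wprod w) == size w.

Lemma tlen_wprod w : (tlen (wprod w) <= size w)%N.
Proof.
elim/last_ind: w => [|w x IH]; first by rewrite /wprod big_nil tlen1.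
rewrite wprod_rcons size_rcons; have := tlenM (wprod w) (lp x).
by rewrite letter1; lia.
Qed.

Lemma wgeo_rcons w x : wgeo (rcons w x) = wgeo w && geodesic (wprod w) (lp x).
Proof.
rewrite /wgeo /geodesic wprod_rcons size_rcons letter1.
have := tlenM (wprod w) (lp x); rewrite letter1.
by have := tlen_wprod w; lia.
Qed.

Lemma normal_form_wprod s w : normal_form s w -> wprod w = s /\ wgeo w.
Proof.
elim=> {s w} [|s w x _ [hp hg] sx]; first by rewrite /wgeo /wprod big_nil tlen1.
by rewrite wprod_rcons hp wgeo_rcons hg hp geodesic_lt ?letter1.
Qed.

Lemma wprod_nf s : wprod (nf s) = s.
Proof. by have [] := normal_form_wprod (nfP s). Qed.

Lemma wgeo_nf s : wgeo (nf s).
Proof. by have [] := normal_form_wprod (nfP s). Qed.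

Definition letter_bas x : A := bas R (lp x).

Lemma eval_word w :
  \prod_(x <- w) letter_bas x =
  if wgeo w then bas R (wprod w) else 0 :> geo_alg R d.
Proof.
elim/last_ind: w => [|w x IH].
  by rewrite /wgeo /wprod !big_nil tlen1.
rewrite -cats1 big_cat big_seq1 /= IH cats1 wprod_rcons wgeo_rcons.
case: (wgeo w) => /=; last by rewrite mul0r.
exact: bas_prod.
Qed.

Lemma coord_nceval (p : ncpoly R letter) s :
  coord (nceval letter_bas p : geo_alg R d) s =
  \sum_(t <- p | wgeo t.2 && (wprod t.2 == s)) t.1.
Proof.
rewrite coord_sum [RHS]big_mkcond; apply: eq_bigr => t _.
rewrite -[LHS]/(coord (geo_scal d t.1 * _ : geo_alg R d) s).
rewrite geo_scalE eval_word coordZ.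
case: (wgeo _) => /=; last by rewrite coord0 mulr0.
by rewrite coord_bas eq_sym; case: eqP; rewrite ?mulr1 ?mulr0.
Qed.

Definition quad_rel (q : ncpoly R letter) :=
  nchomog 2 q /\ nceval letter_bas q = 0.

Lemma quad_rel_word r x y : ~~ geodesic (lp x) (lp y) ->
  quad_rel [:: (r, [:: x; y])].
Proof.
move=> g; split=> //; apply: coordP => s; rewrite coord_nceval coord0.
rewrite big_mkcond big_seq1 /= (wgeo_rcons [:: x]) -[[:: x]]/(rcons [::] x).
by rewrite wprod_rcons /wprod big_nil mul1g (negPf g) andbF.
Qed.

Lemma wprod2 x y : wprod [:: x; y] = (lp x * lp y)%g.
Proof. by rewrite /wprod big_cons big_seq1. Qed.

Lemma wgeo2 x y : wgeo [:: x; y] = geodesic (lp x) (lp y).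
Proof. by rewrite /wgeo wprod2 /geodesic !letter1. Qed.

Lemma quad_rel_words r x y x' y' : geodesic (lp x) (lp y) ->
  geodesic (lp x') (lp y') ->
  (lp x * lp y = lp x' * lp y')%g ->
  quad_rel [:: (r, [:: x; y]); (- r, [:: x'; y'])].
Proof.
move=> g g' e; split=> //; apply: coordP => s; rewrite coord_nceval coord0.
rewrite !big_cons big_nil /= !wgeo2 !wprod2 g g' e /=.
by case: (_ == s); rewrite ?addr0 ?subrr.
Qed.

Local Notation Id := (ncideal quad_rel).

(* If x does not extend the normal form w y, then y x is either zero or equal
   to a product a b in normal form; b has the height of y, so it extends the
   normal form of s a, which is known by induction. *)
Lemma normal_form_mul s w x r : normal_form s w ->
  Id ((r, rcons w x) :: if geodesic s (lp x) then [:: (- r, nf (s * lp x)%g)]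
    else [::]).
Proof.
move=> h; elim: h r x => {s w} [|s w y hw IH sy] r x.
  have h : (height (1 : 'S_d) < height (lp x))%N by rewrite height1;
    have := height_tlen1 (letter1 x); lia.
  rewrite geodesic_lt ?letter1 // nf_rcons //.
  by rewrite (normal_form_uniq (nfP _) NF1); apply: ncideal_refl.
have syx := geodesicA s (lp y) (lp x); rewrite geodesic_lt ?letter1 //= in syx.
have [yx|xy] := ltnP (height (lp y)) (height (lp x)).
  have h : (height (s * lp y)%g < height (lp x))%N by rewrite heightMr.
  rewrite geodesic_lt ?letter1 // nf_rcons // nf_rcons //.
  by rewrite (normal_form_uniq (nfP _) hw); apply: ncideal_refl.
have rE z1 z2 : rcons (rcons w z1) z2 = w ++ [:: z1; z2] ++ [::].
  by rewrite -!cats1 -catA.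
rewrite syx; case: (boolP (geodesic (lp y) (lp x))) => [gyx|gyx] /=; last first.
  by rewrite rE; apply: (ncideal_words w [::] (ncideal_gen (quad_rel_word r
    gyx))).
have myx := height_geodesic (letter1 y) xy gyx.
have /height_decomp[a' [b' [yxE b1 ab]]] : (lp y * lp x)%g != 1%g.
  by apply/eqP => e; move: myx; rewrite e height1;
    have := height_tlen1 (letter1 y); lia.
(* The geodesic product of [y] and [x] has length 2, so splitting off [b'] leaves length 1. *)
have a1 : tlen a' = 1%N.
  have := geodesic_lt b1 ab; move: gyx; rewrite /geodesic -yxE b1 !letter1; lia.
have mb : height b' = height (lp y) by rewrite -myx yxE heightMr.
have [a aE] := letterP a1; have [b bE] := letterP b1.
rewrite -aE -bE in yxE ab mb.
have gab : geodesic (lp a) (lp b) by rewrite geodesic_lt ?letter1.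
apply: (@ncideal_trans _ _ _ r _ (rcons (rcons w a) b)).
  rewrite !rE; exact: (ncideal_words w [::] (ncideal_gen (quad_rel_words r gyx
    gab yxE))).
have sab : (height (s * lp a)%g < height (lp b))%N by have := heightM s (lp a);
  lia.
(* By associativity [s], [a] is a geodesic pair exactly when [s], [y x] is, so the induction
   hypothesis for [a] splits into the same cases as the goal. *)
have := geodesicA s (lp a) (lp b).
rewrite gab (geodesic_lt (letter1 b) sab) andbT /= -yxE => <-.
have := ncideal_words [::] [:: b] (IH r a).
rewrite -mulgA yxE mulgA (@nf_rcons (s * lp a)%g) //.
by case: ifP => _ /=; rewrite !cats1.
Qed.

(** Normalise the prefix first, then absorb the last letter by [normal_form_mul]. *)
Lemma word_nf w r :
  Id ((r, w) :: if wgeo w then [:: (- r, nf (wprod w))] else [::]).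
Proof.
elim/last_ind: w => [|w x IH].
  rewrite /wgeo /wprod big_nil tlen1 eqxx.
  by rewrite (normal_form_uniq (nfP _) NF1); apply: ncideal_refl.
have := ncideal_words [::] [:: x] IH; rewrite wgeo_rcons wprod_rcons.
case: (wgeo w) => /=; rewrite !cats1 //= => h.
exact: ncideal_trans h (normal_form_mul _ _ (nfP _)).
Qed.

(** The sign makes [p ++ poly_nf p] the difference of [p] and its normalisation. *)
Definition poly_nf (p : ncpoly R letter) : ncpoly R letter :=
  [seq (- t.1, nf (wprod t.2)) | t <- p & wgeo t.2].

Lemma poly_nf_ideal p : Id (p ++ poly_nf p).
Proof.
elim: p => [|[r w] p IH]; first exact: ncideal0.
apply: (ncideal_eq _ (ncidealD (word_nf w r) IH)) => u.
rewrite /poly_nf /=; case: (wgeo w) => /=;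
  rewrite !(nccoef_cat, nccoef_cons) //.
by congr (_ + _); apply: addrCA.
Qed.

(** Distinct permutations have distinct normal forms, so the coefficient at [nf s] is, up to sign,
    the coordinate at [s] of the value of [p]. *)
Lemma poly_nf0 p : nceval letter_bas p = 0 -> nceq (poly_nf p) [::].
Proof.
move=> p0 u; rewrite nccoef_nil /nccoef /poly_nf big_map big_filter_cond /=.
have [uE|un] := eqVneq (nf (wprod u)) u; last first.
  rewrite big1 // => t /andP[_ /eqP e].
  by rewrite -e wprod_nf eqxx in un.
rewrite sumrN; apply/eqP; rewrite oppr_eq0; apply/eqP.
have := coord_nceval p (wprod u); rewrite p0 coord0 => e; rewrite [RHS]e.
apply: eq_bigl => t; congr (_ && _); apply/eqP/eqP => [<-|->//].
by rewrite wprod_nf.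
Qed.

Lemma geo_quadratic : quadratic A.
Proof.
exists letter, letter_bas; split.
- split=> [x s s1|f hf|s c us E x xs].
  + by rewrite coord_bas; case: eqP => // e; rewrite e letter1 in s1.
  + exists (enum {: letter}), (fun x => coord f (lp x)).
    apply/eqP; rewrite subr_eq0; apply/eqP/coordP => s;
      rewrite coord_comb big_enum /=.
    have [/letterP[x <-]|s1] := eqVneq (tlen s) 1%N.
      rewrite (bigD1 x) //= big1 => [|y yx];
        first by rewrite coord_bas eqxx mulr1 addr0.
      by rewrite coord_bas (inj_eq val_inj) eq_sym (negPf yx) mulr0.
    rewrite hf // big1 // => x _; rewrite coord_bas.
    by case: eqP => [e|_]; [rewrite e letter1 in s1 | rewrite mulr0].
  + have := congr1 (fun g : geo_alg R d => coord g (lp x)) E.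
    rewrite coord_comb coord0 (bigD1_seq x) //= big1 => [|y yx].
      by rewrite coord_bas eqxx mulr1 addr0.
    by rewrite coord_bas (inj_eq val_inj) eq_sym (negPf yx) mulr0.
- move=> f; exists [seq (coord f s, nf s) | s <- enum {: 'S_d}].
  apply: coordP => s; rewrite coord_nceval big_map big_enum_cond /=.
  rewrite (bigD1 s) /= ?wgeo_nf ?wprod_nf ?eqxx // big1 ?addr0 // => t.
  by rewrite wgeo_nf wprod_nf /= => /andP[->].
(* For a relation [p] the normalisation vanishes, so [p] itself has the coefficients of an element
   of the ideal. *)
- move=> p p0; apply: (ncideal_eq _ (poly_nf_ideal p)) => u.
  by rewrite nccoef_cat poly_nf0 // nccoef_nil addr0.
Qed.

End Quadratic.

Theorem proposition11 (R : comPzRingType) (d : nat) (hd : 1 <= d) :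
  quadratic (geo_galg R d) /\ koszul (geo_galg R d).
Proof. by split; [exact: geo_quadratic | exact: geo_koszul]. Qed.
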